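(* Let $x_1,\ldots,x_m$ be distinct points in the open left half plane $\{\operatorname{Re}(s)<0\}$ and $y_1,\ldots,y_m\in\mathbb{C}$, with the data closed under complex conjugation. Let $\eta(s)=\prod_{j=1}^m(s-x_j)$, $\phi_j(s)=\prod_{k\ne j}(s-x_k)$, let $\gamma_1,\ldots,\gamma_m$ and $c_1,\ldots,c_m$ be non-zero conjugation-compatible coefficients, $0\neq b\in\mathbb{R}$, and put $$d_o=\sum_{j=1}^m\gamma_j\phi_j,\quad d_1=b\eta+\sum_{j=1}^m c_j\phi_j,\quad \nu_o=\sum_{j=1}^m y_j\gamma_j\phi_j,\quad \nu_1=\sum_{j=1}^m y_jc_j\phi_j,$$ $$p_k=\frac{\nu_k}{d_k},\qquad \Delta_k=\frac{\eta}{d_k},\qquad f_k=p_k+r_k\Delta_k\quad (r_k\in\mathbb{R}),\qquad k\in\{o,1\}.$$ Assume that $\Delta_o$ and $\Delta_1$ are strictly positive real. For $k\in\{o,1\}$ let $\underline{r}_k$ denote the smallest $r\in\mathbb{R}$ such that $\operatorname{Re}\big(p_k(s)+r\Delta_k(s)\big)\ge 0$ for all $s$ with $\operatorname{Re}(s)>0$. Then $$\underline{r}_k=-\inf_{\operatorname{Re}(s)>0}\frac{\operatorname{Re}\,p_k(s)}{\operatorname{Re}\,\Delta_k(s)},\qquad k\in\{o,1\},$$ and $f_k$ is positive real if and only if $r_k\ge\underline{r}_k$.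
   Context: Data closed under complex conjugation: the indices are ordered so that $\operatorname{Im}(x_j)>0$ implies $x_{j+1}=\overline{x_j}$ and $y_{j+1}=\overline{y_j}$, every non-real node belongs to such a pair, and $y_j\in\mathbb{R}$ if $x_j\in\mathbb{R}$. Coefficients $c_1,\ldots,c_m\in\mathbb{C}$ are conjugation-compatible if $c_j\in\mathbb{R}$ when $x_j\in\mathbb{R}$ and $c_{j+1}=\overline{c_j}$ when $\operatorname{Im}(x_j)>0$. A rational function $f$ with real coefficients is positive real if $\operatorname{Re}(f(s))\ge 0$ for all $s$ with $\operatorname{Re}(s)>0$; it is strictly positive real if $f(s-\epsilon)$ is positive real for some $\epsilon>0$. *)

(* Defs.v *)
From HB Require Import structures.
From mathcomp Require Import all_boot all_order all_algebra.
From mathcomp Require Import generic_quotient.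
From mathcomp Require Import complex.
From mathcomp Require Import all_classical all_reals all_analysis.

Set Implicit Arguments.
Unset Strict Implicit.
Unset Printing Implicit Defensive.

Import Order.TTheory GRing.Theory Num.Theory.

Local Open Scope quotient_scope.
Local Open Scope ring_scope.
Local Open Scope complex_scope.

(* Complex rational functions are elements of the fraction field of R[i][s]. *)
Notation ratfun R := {fraction {poly R[i]}}.

Notation "p %:F" := (@FracField.tofrac _ p) : ring_scope.

Section RationalFunctions.
Variable R : realType.
Implicit Types (f : ratfun R) (s : R[i]) (eps : R).

(* repr f need not be in lowest terms, so the gcd is divided out: the roots of
   rfden f are then exactly the poles of f. *)
Definition rfnum f : {poly R[i]} :=
  (frac (repr f)).1 %/ gcdp (frac (repr f)).1 (frac (repr f)).2.

Definition rfden f : {poly R[i]} :=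
  (frac (repr f)).2 %/ gcdp (frac (repr f)).1 (frac (repr f)).2.

Definition is_pole f s : bool := root (rfden f) s.

(* The value f(s); it is 0 when s is a pole of f. *)
Definition rfeval f s : R[i] := (rfnum f).[s] / (rfden f).[s].

(* The rational function s |-> f(s - eps). *)
Definition rfshift f eps : ratfun R :=
  (rfnum f \Po ('X - (eps%:C)%:P))%:F / (rfden f \Po ('X - (eps%:C)%:P))%:F.

Definition real_coefs f : Prop :=
  exists2 nd : {poly R} * {poly R}, nd.2 != 0 &
    f = (map_poly (real_complex R) nd.1)%:F
        / (map_poly (real_complex R) nd.2)%:F.

(* The absence of poles in the open right half-plane is what makes the
   condition on Re f(s) meaningful at every such s. *)
Definition positive_real f : Prop :=
  real_coefs f /\
  forall s, 0 < complex.Re s -> ~~ is_pole f s /\ 0 <= complex.Re (rfeval f s).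

Definition strictly_positive_real f : Prop :=
  exists2 eps : R, 0 < eps & positive_real (rfshift f eps).

End RationalFunctions.

Section ConjugationClosedData.
Variables (R : realType) (m : nat).
Implicit Types x y c : 'I_m -> R[i].

Definition conj_closed_data x y : Prop :=
  [/\ forall j, 0 < complex.Im (x j) ->
        exists k : 'I_m,
          [/\ k = j.+1 :> nat, x k = conjc (x j) & y k = conjc (y j)],
      forall j, complex.Im (x j) != 0 ->
        exists i k : 'I_m,
          [/\ 0 < complex.Im (x i), k = i.+1 :> nat & j = i \/ j = k]
    & forall j, complex.Im (x j) = 0 -> complex.Im (y j) = 0].

Definition conj_compatible x c : Prop :=
  (forall j, complex.Im (x j) = 0 -> complex.Im (c j) = 0) /\
  (forall j k : 'I_m, 0 < complex.Im (x j) -> k = j.+1 :> nat ->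
     c k = conjc (c j)).

End ConjugationClosedData.

(* Main.v *)
Require Import Defs.
From mathcomp Require Import all_boot all_order all_algebra.
From mathcomp Require Import complex.
From mathcomp Require Import all_classical all_reals all_analysis.
From mathcomp Require Import zify ring lra generic_quotient.

Set Implicit Arguments.
Unset Strict Implicit.
Unset Printing Implicit Defensive.

Import Order.TTheory GRing.Theory Num.Theory numFieldNormedType.Exports.
Local Open Scope classical_set_scope.
Local Open Scope ring_scope.
Local Open Scope complex_scope.

(* Put Delta = eta / d; strict positive realness gives e > 0 such that d has no
   root and Re Delta >= 0 on Re s > - e.  The number r is admissible iff - r is a
   lower bound of Re p / Re Delta, so everything reduces to |Re p| <= K Re Delta
   on the closed right half-plane.  There Re Delta > 0, which gives the bound on
   compact parts.  Near infinity p = nu / d is bounded, while Delta is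
   beta + a s + O(1 / |s|) with a >= 0; since Re Delta >= 0 already on
   Re s > - e, either Re beta >= a e / 2 > 0, or a = 0 and beta = 1 / b > 0. *)

(** * Rational functions in lowest terms: poles and values of a quotient of polynomials *)

Lemma fraction_repr (A : idomainType) (f : {fraction A}) :
  f = FracField.tofrac (frac (repr f)).1 / FracField.tofrac (frac (repr f)).2.
Proof.
rewrite -{1}[f]reprK; unlock FracField.tofrac.
rewrite -[X in _ * X]FracField.pi_inv -[RHS]FracField.pi_mul.
rewrite /FracField.mulf /FracField.invf.
by rewrite !numden_Ratio ?oner_eq0 ?denom_ratioP // mulr1 mul1r Ratio_numden.
Qed.

Section RationalFunctions.
Variable R : realType.
Implicit Types (n d : {poly R[i]}) (f : ratfun R) (s : R[i]).

Lemma coprimep_rfnum_rfden f : coprimep (rfnum f) (rfden f).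
Proof. by rewrite coprimep_div_gcd // denom_ratioP orbT. Qed.

Lemma rfden_neq0 f : rfden f != 0.
Proof.
rewrite /rfden; apply/eqP => h.
have := divpK (dvdp_gcdr (frac (repr f)).1 (frac (repr f)).2).
by rewrite h mul0r => /eqP; rewrite eq_sym (negPf (denom_ratioP _)).
Qed.

(** [rfnum] and [rfden] come from a chosen representative, so this relation is the only link to the
    given [n] and [d]. It is equality of fractions with the gcd cancelled. *)
Lemma rfnum_rfden_cross n d : d != 0 ->
  rfnum (n%:F / d%:F) * d = n * rfden (n%:F / d%:F).
Proof.
move=> d0; set f := _ / _.
have g0 : gcdp (frac (repr f)).1 (frac (repr f)).2 != 0.
  by rewrite gcdp_eq0 negb_and denom_ratioP orbT.
have := fraction_repr f; rewrite {1}/f => /eqP.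
rewrite eqr_div ?tofrac_eq0 ?denom_ratioP // -!tofracM tofrac_eq => /eqP e.
apply: (mulIf g0); rewrite mulrAC -[RHS]mulrA.
by rewrite !divpK ?dvdp_gcdl ?dvdp_gcdr // -e.
Qed.

(** At a root of [rfden] the cross relation would make [rfnum] vanish too, against their
    coprimality. *)
Lemma rfden_root_ndiv n d s : d.[s] != 0 -> ~~ root (rfden (n%:F / d%:F)) s.
Proof.
move=> ds; have d0 : d != 0 by apply: contraNneq ds => ->; rewrite horner0.
apply/negP => r; have /(congr1 (horner^~ s)) := rfnum_rfden_cross n d0.
rewrite !hornerM (eqP r) mulr0 => /eqP; rewrite mulf_eq0 (negPf ds) orbF.
apply/negP; apply: coprimep_root r.
by rewrite coprimep_sym coprimep_rfnum_rfden.
Qed.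

Lemma rfeval_div n d s : d.[s] != 0 -> rfeval (n%:F / d%:F) s = n.[s] / d.[s].
Proof.
move=> ds; have d0 : d != 0 by apply: contraNneq ds => ->; rewrite horner0.
have /(congr1 (horner^~ s)) := rfnum_rfden_cross n d0; rewrite !hornerM => e.
by apply/eqP; rewrite eqr_div // -?rootE ?rfden_root_ndiv // e.
Qed.

(** At a zero of [d] the cross relation makes [n] or [rfden] vanish, and coprimality rules out the
    former. *)
Lemma rfden_root_div n d s : coprimep n d -> d != 0 ->
  ~~ root (rfden (n%:F / d%:F)) s -> d.[s] != 0.
Proof.
move=> cop d0 h; apply/negP => /eqP ds.
have /(congr1 (horner^~ s)) := rfnum_rfden_cross n d0.
rewrite !hornerM ds mulr0 => /esym/eqP; rewrite mulf_eq0 -[_.[s] == 0]rootE.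
rewrite -[(rfden _).[s] == 0]rootE (negPf h) orbF => ns.
by have := coprimep_root cop ns; rewrite ds eqxx.
Qed.

Lemma strictly_positive_real_div n d : coprimep n d -> d != 0 ->
  strictly_positive_real (n%:F / d%:F) ->
  exists2 e : R, 0 < e & forall s, - e < complex.Re s ->
    d.[s] != 0 /\ 0 <= complex.Re (n.[s] / d.[s]).
Proof.
move=> cop d0 [e e0 [_ pr]]; exists e => // s hs.
set f := n%:F / d%:F in pr *.
have comp_neq0 : rfden f \Po ('X - (e%:C)%:P) != 0.
  by rewrite comp_poly2_eq0 ?rfden_neq0 // size_XsubC.
have cop' : coprimep (rfnum f \Po ('X - (e%:C)%:P)) (rfden f \Po ('X - (e%:C)%:P)).
  exact: coprimep_comp_poly (coprimep_rfnum_rfden f).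
(* The shifted function at [s + e] takes the value of the original one at [s]. *)
have hs' : 0 < complex.Re (s + e%:C) by case: s hs => a b /=; lra.
have [np ge0] := pr _ hs'.
have nz := rfden_root_div cop' comp_neq0 np.
move: ge0; rewrite /rfshift rfeval_div // !horner_comp !hornerE addrK.
move: nz; rewrite horner_comp !hornerE addrK => nz.
have ds : d.[s] != 0 by apply: (rfden_root_div cop d0); rewrite rootE.
by rewrite -[_ / _]/(rfeval f s) rfeval_div.
Qed.

End RationalFunctions.

Local Notation Re := complex.Re.
Local Notation Im := complex.Im.
Local Notation normc := Normc.normc.

(** * Real parts, moduli and roots of complex numbers *)

Section ComplexNumbers.
Variable R : realType.
Implicit Types (s z w : R[i]) (p q : {poly R[i]}).

Lemma ReD z w : Re (z + w) = Re z + Re w.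
Proof. by case: z; case: w. Qed.

Lemma ImD z w : Im (z + w) = Im z + Im w.
Proof. by case: z; case: w. Qed.

Lemma ReM z w : Re (z * w) = Re z * Re w - Im z * Im w.
Proof. by case: z; case: w. Qed.

Lemma ImM z w : Im (z * w) = Re z * Im w + Im z * Re w.
Proof. by case: z; case: w. Qed.

Lemma ReMl (a : R) z : Re (a%:C * z) = a * Re z.
Proof. by rewrite ReM /= mul0r subr0. Qed.

Lemma Re_sum (I : Type) (r : seq I) (F : I -> R[i]) :
  Re (\sum_(i <- r) F i) = \sum_(i <- r) Re (F i).
Proof. exact: (big_morph (@complex.Re R) ReD erefl). Qed.

Lemma Re_div z w :
  Re (z / w) = (Re z * Re w + Im z * Im w) / (Re w ^+ 2 + Im w ^+ 2).
Proof. by case: z w => [a b] [c d] /=; rewrite mulrN opprK mulrDl !mulrA. Qed.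

Lemma normc_sqr_gt0 w : w != 0 -> 0 < Re w ^+ 2 + Im w ^+ 2.
Proof.
rewrite eq_complex => w0; rewrite lt_neqAle addr_ge0 ?sqr_ge0 // andbT eq_sym.
by rewrite paddr_eq0 ?sqr_ge0 // !sqrf_eq0.
Qed.

Lemma normc_ge0 z : 0 <= normc z.
Proof. by case: z => a b; exact: sqrtr_ge0. Qed.

Lemma normc_gt0 z : z != 0 -> 0 < normc z.
Proof.
move=> z0; rewrite lt_neqAle normc_ge0 andbT eq_sym.
by apply: contra z0 => /eqP/Normc.eq0_normc ->.
Qed.

Lemma abs_Re_le z : `|Re z| <= normc z.
Proof. by case: z => a b; rewrite -sqrtr_sqr ler_sqrt ?lerDl ?addr_ge0 ?sqr_ge0. Qed.

Lemma abs_Im_le z : `|Im z| <= normc z.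
Proof. by case: z => a b; rewrite -sqrtr_sqr ler_sqrt ?lerDr ?addr_ge0 ?sqr_ge0. Qed.

Lemma normc_ler z w : normc (z + w) <= normc z + normc w.
Proof. exact: le_normcD. Qed.

Lemma normc_rC (a : R) : normc a%:C = `|a|.
Proof. by rewrite /= expr0n addr0 sqrtr_sqr. Qed.

Lemma normcX z n : normc (z ^+ n) = normc z ^+ n.
Proof. by elim: n => [|n IH]; rewrite ?Normc.normc1 // !exprS Normc.normcM IH. Qed.

(* The [k]-th roots of [v] sum to zero, so they cannot all have negative real
   part. *)
Lemma exists_root_Re_ge0 k (v : R[i]) : (1 < k)%N ->
  exists2 u, u ^+ k = v & 0 <= Re u.
Proof.
move=> k1; have k0 : (0 < k)%N by exact: ltnW.
pose p : {poly R[i]} := 'X^k - v%:P.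
have [rs] := closed_field_poly_normal p; have lp := lead_coefXnsubC v k0.
rewrite lp scale1r => e.
have sz : size rs = k.
  by have := size_XnsubC v k0; rewrite -/p e size_prod_XsubC => -[].
have sum0 : \sum_(z <- rs) z = 0.
  apply/eqP; rewrite -oppr_eq0 -coefPn_prod_XsubC ?sz ?lt0n_neq0 //.
  rewrite -e coefB coefXn coefC ltn_eqF ?prednK //.
  by rewrite -subn1 subn_eq0 leqNgt k1 subrr.
have [/hasP[u urs Reu]|/hasPn neg] := boolP (has (fun z => 0 <= Re z) rs).
  exists u => //; have : root p u by rewrite e root_prod_XsubC.
  by rewrite /p rootE !hornerE subr_eq0 => /eqP.
exfalso; case: rs sz sum0 neg {e} => [|z rs] sz sum0 neg; first by rewrite -sz in k0.
move/(congr1 (@complex.Re R)): sum0; rewrite big_cons ReD Re_sum /= => sum0.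
have := neg z (mem_head _ _); rewrite -ltNge.
have : \sum_(i <- rs) Re i <= 0.
  rewrite big_seq sumr_le0 // => i irs; rewrite ltW // ltNge neg //.
  by rewrite inE irs orbT.
lra.
Qed.

End ComplexNumbers.

(** * Growth of polynomials and of their quotients at infinity *)

Section Asymptotics.
Variable R : realType.
Implicit Types (s z w : R[i]) (n d p q : {poly R[i]}).

(** The extra factor [normc s] on the left lets the exponent be the size instead of the degree, so
    the zero polynomial needs no separate treatment later. *)
Lemma horner_normc_le p : exists2 C : R, 0 <= C &
  forall k s, (size p <= k)%N -> 1 <= normc s ->
    normc s * normc p.[s] <= C * normc s ^+ k.
Proof.
elim/poly_ind: p => [|p c [C C0 IH]].
  by exists 0 => // k s _ _; rewrite horner0 Normc.normc0 mulr0 mul0r.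
exists (C + normc c); first by rewrite addr_ge0 ?normc_ge0.
move=> [|k] s; first by rewrite size_poly_leq0 => /eqP -> _; rewrite horner0
  Normc.normc0 mulr0 mulr1 addr_ge0 ?normc_ge0.
rewrite size_MXaddC => hk s1; rewrite !hornerE.
have {}hk : (size p <= k)%N.
  by move: hk; case: ifP => [/andP[/eqP -> _]|_ //]; rewrite size_poly0.
have s0 : 0 <= normc s by exact: normc_ge0.
apply: (le_trans (ler_wpM2l s0 (normc_ler _ _))).
rewrite mulrDr mulrDl lerD //.
  by rewrite Normc.normcM mulrA exprSr mulrA ler_wpM2r // IH.
by rewrite mulrC ler_wpM2l ?normc_ge0 // exprS ler_peMr // exprn_ege1.
Qed.

Lemma horner_normc_ge p : p != 0 -> exists2 c : R, 0 < c &
  exists rho : R, forall s, rho <= normc s ->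
    c * normc s ^+ (size p) <= normc s * normc p.[s].
Proof.
move=> p0; have sp : (0 < size p)%N by rewrite size_poly_gt0.
pose k := (size p).-1; pose l := lead_coef p.
have l0 : 0 < normc l by rewrite normc_gt0 // lead_coef_eq0.
pose p' := p - l *: 'X^k.
have sp' : (size p' <= k)%N.
  apply/leq_sizeP => j; rewrite coefB coefZ coefXn leq_eqVlt => /orP[/eqP <-|kj].
    by rewrite eqxx mulr1 /l lead_coefE subrr.
  by rewrite gtn_eqF // mulr0 subr0 nth_default // -[size p]prednK.
have [C C0 hC] := horner_normc_le p'.
exists (normc l / 2); first lra.
(* Beyond [2 * C / normc l] the lower-order part [p'] is at most half the leading term. *)
exists (Num.max 1 (2 * C / normc l)) => s; rewrite ge_max => /andP[s1 sC].
have := hC k s sp' s1; rewrite /p' !hornerE => h.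
have e : l * s ^+ k = p.[s] - (p.[s] - l * s ^+ k) by ring.
have := normc_ler p.[s] (- (p.[s] - l * s ^+ k)).
rewrite -e normcN Normc.normcM normcX => h2.
rewrite -[size p]prednK // -/k exprS.
have sk : 0 <= normc s ^+ k by rewrite exprn_ge0 // normc_ge0.
move: sC; rewrite ler_pdivrMr // => sC.
have s0 : 0 <= normc s by exact: normc_ge0.
have := ler_wpM2l s0 h2; have := ler_wpM2r sk sC.
move: (normc s ^+ k) (normc (p.[s] - _)) h sk => A B; nra.
Qed.

Lemma ratio_normc_le n d : d != 0 -> (size n <= size d)%N ->
  exists2 C : R, 0 <= C & exists rho : R, forall s, rho <= normc s ->
    normc (n.[s] / d.[s]) <= C.
Proof.
move=> d0 snd; have [C C0 hC] := horner_normc_le n.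
have [c c0 [rho hc]] := horner_normc_ge d0.
exists (C / c); first by rewrite divr_ge0 // ltW.
exists (Num.max 1 rho) => s; rewrite ge_max => /andP[s1 /hc hd].
have s0 : 0 < normc s by exact: lt_le_trans s1.
have := hC _ _ snd s1 => hn.
have sk : 0 < normc s ^+ size d by rewrite exprn_gt0.
have dp : 0 < normc d.[s].
  by rewrite -(pmulr_rgt0 _ s0) (lt_le_trans _ hd) // mulr_gt0.
rewrite Normc.normcM Normc.normcV ler_pdivrMr // mulrAC ler_pdivlMr //.
rewrite -(ler_pM2l s0) mulrA.
apply: (le_trans (ler_wpM2r (ltW c0) hn)).
by have := ler_wpM2l C0 hd; nra.
Qed.

Lemma ratio_normc_vanish n d : d != 0 -> (size n < size d)%N ->
  exists2 C : R, 0 <= C & exists rho : R, forall s, rho <= normc s ->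
    normc s * normc (n.[s] / d.[s]) <= C.
Proof.
move=> d0 snd; have snX : (size (n * 'X)%R <= size d)%N.
  have [->|n0] := eqVneq n 0; first by rewrite mul0r size_poly0.
  by rewrite size_mulX.
have [C C0 [rho h]] := ratio_normc_le d0 snX.
exists C => //; exists rho => s /h.
by rewrite !hornerE mulrAC [_ * s]mulrC Normc.normcM.
Qed.

(** Along the ray [t * u] the real part of [q] is a real polynomial in [t] with this leading
    coefficient; a negative one would drive it below [- C]. *)
Lemma Re_lead_coef_ge0 q (C rho : R) : (1 < size q)%N ->
  (forall s, 0 <= Re s -> rho <= normc s -> - C <= Re q.[s]) ->
  forall u, 0 <= Re u -> 0 <= Re (lead_coef q * u ^+ (size q).-1).
Proof.
move=> sq hq u Reu; rewrite leNgt; apply/negP => neg.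
pose P : {poly R} := \poly_(i < size q) Re (q`_i * u ^+ i).
have PE (t : R) : P.[t] = Re q.[t%:C * u].
  rewrite horner_poly horner_coef Re_sum; apply: eq_bigr => i _.
  by rewrite exprMn mulrCA -rmorphXn ReMl mulrC.
have u0 : u != 0.
  apply: contraTneq neg => ->.
  by rewrite expr0n -subn1 subn_eq0 leqNgt sq mulr0 ltxx.
have P1 : P`_(size q).-1 = Re (lead_coef q * u ^+ (size q).-1).
  by rewrite coef_poly prednK ?leqnn // ltnW.
have sP : size P = size q.
  apply/eqP; rewrite eqn_leq size_poly /=.
  rewrite -(prednK (ltnW sq)) ltnNge; apply/negP => /leq_sizeP/(_ _ (leqnn _)).
  by rewrite P1 => /eqP; rewrite lt_eqF.
pose Q := - P - C%:P.
have sC : (size (- C%:P : {poly R})%R < size (- P)%R)%N.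
  by rewrite !size_polyN sP (leq_ltn_trans (size_polyC_leq1 _)).
have lQ : lead_coef Q = - Re (lead_coef q * u ^+ (size q).-1).
  by rewrite lead_coefDl // lead_coefN lead_coefE sP P1.
have : 0 < lead_coef Q by rewrite lQ oppr_gt0.
move=> lQ0; have [t0 ht0] := polyrcf.poly_pinfty_gt_lc lQ0.
have nu := normc_gt0 u0.
pose t := Num.max (Num.max t0 0) (rho / normc u).
have /ht0 : t0 <= t by rewrite !le_max lexx.
have tge : 0 <= t by rewrite !le_max lexx orbT.
have trho : rho <= normc (t%:C * u).
  by rewrite Normc.normcM normc_rC ger0_norm // -ler_pdivrMr // le_max lexx orbT.
have : 0 <= Re (t%:C * u) by rewrite ReMl mulr_ge0.
move=> /hq/(_ trho); rewrite -PE /Q !hornerE.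
lra.
Qed.

Lemma affine_of_Re_bounded_below q (C rho : R) :
  (forall s, 0 <= Re s -> rho <= normc s -> - C <= Re q.[s]) ->
  exists2 a : R, 0 <= a & exists beta : R[i], q = beta%:P + a%:C *: 'X.
Proof.
move=> hq; have [sq|sq] := leqP (size q) 1.
  by exists 0 => //; exists q`_0; rewrite scale0r addr0 -size1_polyC.
have h := Re_lead_coef_ge0 sq hq.
have lq0 : lead_coef q != 0 by rewrite lead_coef_eq0 -size_poly_gt0 ltnW.
have sq2 : (size q <= 2)%N.
  rewrite leqNgt; apply/negP => sq3.
  have k1 : (1 < (size q).-1)%N by rewrite -ltnS prednK // ltnW.
  (* In degree at least 2 this direction makes the leading term equal to -1, which is forbidden. *)
  have [u uE Reu] := exists_root_Re_ge0 (- (lead_coef q)^-1) k1.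
  have := h u Reu; rewrite uE mulrN divff //=.
  by rewrite oppr_ge0 ler10.
have sqE : size q = 2 by apply/eqP; rewrite eqn_leq sq2.
exists (Re (lead_coef q)).
  by have := h 1 ler01; rewrite expr1n mulr1.
have Im0 : Im (lead_coef q) = 0.
  (* The directions ['i] and [- 'i] give opposite signs to the imaginary part of the leading
     coefficient, so it vanishes. *)
  have := h 'i (lexx _); have := h (- 'i); rewrite sqE /= !expr1 oppr0 !ReM /=.
  by move=> /(_ (lexx _)); lra.
exists q`_0.
have -> : (Re (lead_coef q))%:C = lead_coef q.
  by apply/eqP; rewrite eq_complex /= Im0 !eqxx.
rewrite lead_coefE sqE; apply/polyP => -[|[|i]]; rewrite coefD coefC coefZ coefX /=.
- by rewrite mulr0 addr0.
- by rewrite add0r mulr1.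
- by rewrite mulr0 addr0 nth_default // sqE.
Qed.

End Asymptotics.

(* Write n / d = beta + a s + O(1 / |s|).  Far away on the line Re s = - e / 2,
   nonnegativity forces a e / 2 <= Re beta, which is the gap to zero on the
   closed right half-plane. *)
Lemma Re_div_ge_far (R : realType) (n d : {poly R[i]}) (e : R) :
  0 < e -> d != 0 -> (size d <= size n)%N ->
  (forall s, - e < Re s -> d.[s] != 0 /\ 0 <= Re (n.[s] / d.[s])) ->
  (size n = size d -> Re (lead_coef n / lead_coef d) != 0) ->
  (size n <= (size d).+1)%N /\
  exists2 delta : R, 0 < delta & exists rho : R, forall s,
    0 <= Re s -> rho <= normc s -> delta <= Re (n.[s] / d.[s]).
Proof.
move=> e0 d0 sdn pos lead0; have sd : (0 < size d)%N by rewrite size_poly_gt0.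
have [C C0 [rho hr]] := ratio_normc_vanish d0 (ltn_modpN0 n d0).
have divE s : - e < Re s ->
    Re (n.[s] / d.[s]) = Re (n %/ d).[s] + Re ((n %% d).[s] / d.[s]).
  move=> /pos [ds _]; rewrite [in LHS](divp_eq n d) !hornerE mulrDl mulfK //.
  exact: ReD.
have modp_le s : Num.max 1 rho <= normc s ->
    `|Re ((n %% d).[s] / d.[s])| * normc s <= C.
  rewrite ge_max => /andP[s1 /hr]; apply: le_trans.
  by rewrite mulrC ler_wpM2l ?normc_ge0 ?abs_Re_le.
(* For [normc s >= 1] the remainder term has real part at most [C], so the polynomial part is
   bounded below by [- C]. *)
have [|a a0 [beta qE]] := @affine_of_Re_bounded_below _ (n %/ d) C (Num.max 1 rho).
  move=> s s0 srho; have es : - e < Re s by lra.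
  have [_] := pos s es; rewrite divE // => h.
  have h2 := modp_le s srho; move: srho; rewrite ge_max => /andP[s1 _].
  have := ler_norm (Re ((n %% d).[s] / d.[s])).
  have := normr_ge0 (Re ((n %% d).[s] / d.[s])).
  by move: h h2; set x := Re (_ / _); nra.
have sq : size (n %/ d) = (size n - (size d).-1)%N by rewrite size_divp.
have ReqE s : Re (n %/ d).[s] = Re beta + a * Re s.
  by rewrite qE !hornerE ReD ReMl.
have beta_ge : a * (e / 2) <= Re beta.
  rewrite leNgt; apply/negP => neg.
  (* At height [t] the deficit [a * (e / 2) - Re beta], multiplied by the modulus, is at least
     [C + 1], more than the remainder can offset. *)
  pose t := Num.max (Num.max 1 rho) ((C + 1) / (a * (e / 2) - Re beta)).
  pose s : R[i] := (- (e / 2)) +i* t.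
  have t1 : Num.max 1 rho <= t by rewrite le_max lexx.
  have t2 : (C + 1) / (a * (e / 2) - Re beta) <= t by rewrite le_max lexx orbT.
  have t0 : 0 < t by move: t1; rewrite ge_max => /andP[]; lra.
  have ts : t <= normc s by have := abs_Im_le s; rewrite /= gtr0_norm.
  have es : - e < Re s by rewrite /=; lra.
  have [_] := pos s es; rewrite divE // ReqE /=.
  have := modp_le s (le_trans t1 ts).
  have := ler_norm (Re ((n %% d).[s] / d.[s])).
  have := normr_ge0 (Re ((n %% d).[s] / d.[s])).
  move: t2; rewrite ler_pdivrMr ?subr_gt0 //.
  by set X := Re ((n %% d).[s] / d.[s]); nra.
(* If [a = 0], the polynomial quotient is the constant [beta], which is then the ratio of the
   leading coefficients and has nonzero real part by hypothesis. *)
have beta0 : 0 < Re beta.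
  move: a0; rewrite le_eqVlt => /orP[/eqP a0|a0]; last first.
    by apply: lt_le_trans beta_ge; rewrite mulr_gt0 // divr_gt0.
  rewrite lt_neqAle eq_sym; apply/andP; split; last by rewrite -[0](mul0r (e/2)) {1}a0.
  move: qE; rewrite -a0 scale0r addr0 => qE.
  have snd : size n = size d.
    by have := size_polyC_leq1 beta; rewrite -qE sq; lia.
  have b0 : n %/ d != 0 by rewrite -size_poly_gt0 sq; lia.
  have := lead0 snd; rewrite {1}(divp_eq n d) lead_coefDl.
    by rewrite lead_coefM qE lead_coefC mulfK // lead_coef_eq0.
  rewrite (leq_trans (ltn_modpN0 n d0)) // size_mul //.
  by move: b0; rewrite -size_poly_gt0 => b0; rewrite -(prednK b0) addSn leq_addl.
split.
  have : (size (n %/ d)%R <= 2)%N.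
    rewrite qE (leq_trans (size_polyD _ _)) // geq_max.
    rewrite (leq_trans (size_polyC_leq1 _)) //.
    by rewrite (leq_trans (size_scale_leq _ _)) // size_polyX.
  by rewrite sq; lia.
exists (Re beta / 2); first lra.
exists (Num.max (Num.max 1 rho) (2 * C / Re beta)) => s s0.
rewrite ge_max => /andP[srho]; rewrite ler_pdivrMr // => sC.
have es : - e < Re s by lra.
rewrite divE // ReqE.
have := modp_le s srho; move: srho; rewrite ge_max => /andP[s1 _].
have := ler_norm (- Re ((n %% d).[s] / d.[s])); rewrite normrN.
have as0 := mulr_ge0 a0 s0.
by move: as0 sC s1; set X := Re ((n %% d).[s] / d.[s]); nra.
Qed.

(** * Continuity, strict positivity and domination on the half-plane *)

Section Continuity.
Variable R : realType.
Implicit Types p q : {poly R[i]}.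

(** The parametrization by [u] and [v] covers both a line through a point and a rectangle of the
    plane. *)
Lemma continuous_Re_Im_horner (T : topologicalType) (u v : T -> R) p :
  continuous u -> continuous v ->
  continuous (fun t => Re p.[u t +i* v t]) /\
  continuous (fun t => Im p.[u t +i* v t]).
Proof.
move=> cu cv; elim/poly_ind: p => [|p c [cRe cIm]].
  split => t; under [X in continuous_at _ X]funext do rewrite horner0;
    exact: cst_continuous.
split.
  have -> : (fun t => Re (p * 'X + c%:P).[u t +i* v t]) = (fun t =>
      (Re p.[u t +i* v t] * u t - Im p.[u t +i* v t] * v t) + Re c).
    by apply/funext => t; rewrite !hornerE ReD ReM.
  move=> t; apply: cvgD; last exact: cvg_cst.
  by apply: cvgB; apply: cvgM; [exact: cRe|exact: cu|exact: cIm|exact: cv].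
have -> : (fun t => Im (p * 'X + c%:P).[u t +i* v t]) = (fun t =>
    (Re p.[u t +i* v t] * v t + Im p.[u t +i* v t] * u t) + Im c).
  by apply/funext => t; rewrite !hornerE ImD ImM.
move=> t; apply: cvgD; last exact: cvg_cst.
by apply: cvgD; apply: cvgM; [exact: cRe|exact: cv|exact: cIm|exact: cu].
Qed.

(** This is the real part of [p] times the conjugate of [q]: it has the sign of [Re (p / q)] where
    [q] is nonzero, and involves no division. *)
Lemma continuous_Re_mul_conj (T : topologicalType) (u v : T -> R) p q :
  continuous u -> continuous v ->
  continuous (fun t => Re p.[u t +i* v t] * Re q.[u t +i* v t] +
                       Im p.[u t +i* v t] * Im q.[u t +i* v t]).
Proof.
move=> cu cv; have [cRp cIp] := continuous_Re_Im_horner p cu cv.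
have [cRq cIq] := continuous_Re_Im_horner q cu cv => t.
by apply: cvgD; apply: cvgM; [exact: cRp|exact: cRq|exact: cIp|exact: cIq].
Qed.

End Continuity.

(* If the real part of [n / d] vanished at [s0], then near [s0] the quotient
   would be [n / d = w + (s - s0)^k Q / d] with [Re w = 0], and along a suitable
   direction its real part would be negative. *)
Lemma Re_div_gt0 (R : realType) (n d : {poly R[i]}) (e : R) :
  coprimep n d -> (1 < size n)%N ->
  (forall s, - e < Re s -> d.[s] != 0 /\ 0 <= Re (n.[s] / d.[s])) ->
  forall s, - e < Re s -> 0 < Re (n.[s] / d.[s]).
Proof.
move=> cop sn pos s0 es0; have [ds0 ge0] := pos s0 es0.
rewrite lt_neqAle ge0 andbT eq_sym; apply/eqP => Rew.
set w := _ / _ in Rew; pose g := n - w *: d.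
(* If [n] were [w *: d], a root of the nonconstant [n] would be shared with [d], unless [w], hence
   [n], were zero. *)
have g0 : g != 0.
  rewrite subr_eq0; apply/negP => /eqP nE.
  have /closed_rootP[z nz] : size n != 1 by rewrite gtn_eqF.
  have := coprimep_root cop nz; move: (nz); rewrite rootE nE !hornerE mulf_eq0.
  move=> /orP[/eqP w0|/eqP ->]; last by rewrite eqxx.
  by move: sn; rewrite nE w0 scale0r size_poly0.
have gs0 : g.[s0] = 0 by rewrite !hornerE /w divfK // subrr.
have [k [Q]] := multiplicity_XsubC g s0; rewrite g0 /= => Qs0 gE.
have k0 : (0 < k)%N.
  rewrite lt0n; apply: contraNneq Qs0 => k0.
  by move: gE; rewrite k0 expr0 mulr1 => <-; rewrite rootE gs0.
(* With this [z], the product of [z ^+ k * Q.[s0]] and the conjugate of [d.[s0]] is minus the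
   product of the squared moduli of [Q.[s0]] and [d.[s0]], hence negative. *)
pose z := k.-root (- (conjc Q.[s0] * d.[s0])).
have zk : z ^+ k = - (conjc Q.[s0] * d.[s0]) by rewrite rootCK.
pose P := z ^+ k *: Q.
pose u (t : R) : R := Re s0 + t * Re z; pose v (t : R) : R := Im s0 + t * Im z.
have uvE t : u t +i* v t = s0 + t%:C * z.
  apply/eqP; rewrite eq_complex /u /v /=.
  by case: (s0) (z) => [? ?] [? ?] /=; rewrite !mul0r subr0 addr0 !eqxx.
have cont (a b : R) : continuous (fun t : R => a + t * b).
  by move=> t; apply: cvgD; [exact: cvg_cst|apply: cvgM; [exact: cvg_id|exact: cvg_cst]].
have cu : continuous u by exact: cont.
have cv : continuous v by exact: cont.
pose h t := Re P.[u t +i* v t] * Re d.[u t +i* v t] +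
            Im P.[u t +i* v t] * Im d.[u t +i* v t].
have ch : continuous h by exact: continuous_Re_mul_conj.
have h0 : h 0 < 0.
  rewrite /h uvE mul0r addr0 /P hornerZ zk.
  have -> : forall a b : R[i],
      Re (- (conjc a * b) * a) * Re b + Im (- (conjc a * b) * a) * Im b =
      - ((Re a ^+ 2 + Im a ^+ 2) * (Re b ^+ 2 + Im b ^+ 2)).
    by move=> [a1 a2] [b1 b2] /=; ring.
  by rewrite oppr_lt0 mulr_gt0 // normc_sqr_gt0.
have : \forall t \near (0 : R), h t < 0 /\ - e < u t.
  apply: filterI; first exact: cvgr_lt (ch 0) _ h0.
  by apply: cvgr_gt (cu 0) _ _; rewrite /u mul0r addr0.
move=> /nbhs_ballP[r /= r0 hr].
have [ht ut] : h (r / 2) < 0 /\ - e < u (r / 2).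
  apply: hr; rewrite /ball /= sub0r normrN gtr0_norm ?divr_gt0 //.
  by rewrite ltr_pdivrMr // ltr_pMr // ltr1n.
have [dt] := pos (u (r / 2) +i* v (r / 2)) ut.
set s := (_ +i* _) in dt *.
have nE : n.[s] / d.[s] = w + ((r / 2) ^+ k)%:C * (P.[s] / d.[s]).
  have -> : n.[s] = w * d.[s] + g.[s] by rewrite /g hornerD hornerN hornerZ addrC subrK.
  have sE : s - s0 = (r / 2)%:C * z by rewrite /s uvE addrC addKr.
  rewrite mulrDl mulfK // gE hornerM horner_exp hornerXsubC sE.
  by rewrite /P hornerZ exprMn rmorphXn; ring.
rewrite nE ReD Rew add0r ReMl pmulr_rge0 ?exprn_gt0 ?divr_gt0 //.
by rewrite Re_div pmulr_lge0 ?invr_gt0 ?normc_sqr_gt0 // leNgt -/(h (r / 2)) ht.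
Qed.

(** After multiplication by the squared modulus of [d], both sides become continuous functions on a
    compact rectangle containing the half-disc; [K] is the maximum of one over the positive minimum
    of the other. *)
Lemma Re_div_dominated_near (R : realType) (n d v : {poly R[i]}) (rho : R) :
  (forall s, 0 <= Re s -> d.[s] != 0 /\ 0 < Re (n.[s] / d.[s])) ->
  exists K : R, forall s, 0 <= Re s -> normc s <= rho ->
    `|Re (v.[s] / d.[s])| <= K * Re (n.[s] / d.[s]).
Proof.
move=> pos; have [rho0|rho0] := ltP rho 0.
  exists 0 => s _ srho.
  by have := le_lt_trans (le_trans (normc_ge0 s) srho) rho0; rewrite ltxx.
pose A : set (R * R) := `[0, rho] `*` `[- rho, rho].
have cA : compact A by apply: compact_setX; exact: segment_compact.
have A0 : A !=set0 by exists (0, 0); rewrite /A /= !in_itv /= lexx rho0 oppr_le0 rho0.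
have c1 : continuous (fun t : R * R => t.1) by move=> t; exact: cvg_fst.
have c2 : continuous (fun t : R * R => t.2) by move=> t; exact: cvg_snd.
pose H p (t : R * R) := Re p.[t.1 +i* t.2] * Re d.[t.1 +i* t.2] +
                        Im p.[t.1 +i* t.2] * Im d.[t.1 +i* t.2].
have cH p : {within A, continuous (H p)}.
  by apply: continuous_subspaceT; exact: continuous_Re_mul_conj.
have [c cinA cmin] := compact_EVT_min A0 cA (cH n).
have cN : {within A, continuous (fun t => `|H v t|)}.
  by move=> t; apply: cvg_norm; exact: cH.
have [c' _ cmax] := compact_EVT_max A0 cA cN.
have Hc : 0 < H n c.
  move: cinA; rewrite inE /A /= !in_itv /= => -[/andP[c10 _] _].
  have [dc] := pos (c.1 +i* c.2) c10.
  by rewrite Re_div pmulr_lgt0 // invr_gt0 normc_sqr_gt0.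
exists (`|H v c'| / H n c) => s s0 srho; have [ds _] := pos s s0.
have sA : (Re s, Im s) \in A.
  rewrite inE /A /= !in_itv /= s0 -ler_norml; split.
    by rewrite (le_trans (ler_norm _)) // (le_trans (abs_Re_le s)).
  by rewrite (le_trans (abs_Im_le s)).
have sE : Re s +i* Im s = s by case: (s).
have := cmin _ sA; have := cmax _ sA; rewrite /H sE -!/(H _ _) => hv hn.
have dp := normc_sqr_gt0 ds.
rewrite !Re_div normrM [`|_^-1|]gtr0_norm ?invr_gt0 // mulrA ler_pM2r ?invr_gt0 //.
by rewrite mulrAC ler_pdivlMr // ler_pM // ltW.
Qed.

(** Near the origin compactness applies; far away the left side is bounded by [C] while [Re (n / d)]
    stays above [delta], which gives the constant [C / delta]. *)
Lemma Re_div_dominated (R : realType) (n d v : {poly R[i]}) (e : R) :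
  0 < e -> coprimep n d -> (1 < size n)%N -> d != 0 ->
  (size d <= size n)%N -> (size v < size n)%N ->
  (size n = size d -> Re (lead_coef n / lead_coef d) != 0) ->
  (forall s, - e < Re s -> d.[s] != 0 /\ 0 <= Re (n.[s] / d.[s])) ->
  exists K : R, forall s, 0 <= Re s ->
    `|Re (v.[s] / d.[s])| <= K * Re (n.[s] / d.[s]).
Proof.
move=> e0 cop sn d0 sdn svn lead0 pos.
have spos s : 0 <= Re s -> d.[s] != 0 /\ 0 < Re (n.[s] / d.[s]).
  move=> s0; have es : - e < Re s by lra.
  by split; [case: (pos s es)|exact: Re_div_gt0 es].
have [snd [delta delta0 [rho far]]] := Re_div_ge_far e0 d0 sdn pos lead0.
have svd : (size v <= size d)%N by rewrite -ltnS (leq_trans svn).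
have [C C0 [rho' hC]] := ratio_normc_le d0 svd.
have [K near] := Re_div_dominated_near v (Num.max rho rho') spos.
exists (Num.max K (C / delta)) => s s0; have [_ gt0] := spos s s0.
have [/(near s s0) h|/ltW] := leP (normc s) (Num.max rho rho').
  by apply: le_trans h _; rewrite ler_pM2r // le_max lexx.
rewrite ge_max => /andP[/(far s s0) h1 /hC h2].
apply: (le_trans (abs_Re_le _)); apply: (le_trans h2).
apply: (@le_trans _ _ (C / delta * Re (n.[s] / d.[s]))).
  by rewrite mulrAC ler_pdivlMr // ler_wpM2l.
by rewrite ler_pM2r // le_max lexx orbT.
Qed.

(** * Real coefficients and the threshold for positive realness *)

Section RealCoefficients.
Variable R : realType.
Implicit Types (p q n d : {poly R[i]}).

Lemma map_conjc_real p : map_poly (@conjc R) p = p ->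
  p = map_poly (real_complex R) (map_poly (@complex.Re R) p).
Proof.
move=> pE; apply/polyP => i; rewrite coef_map /= coef_map_id0 //.
apply/eqP; rewrite eq_complex /= eqxx /=; apply/eqP.
move/(congr1 (fun q => Im q`_i)): pE; rewrite coef_map.
by case: (p`_i) => a b /=; lra.
Qed.

Lemma real_coefs_div n d : d != 0 -> map_poly (@conjc R) n = n ->
  map_poly (@conjc R) d = d -> real_coefs (n%:F / d%:F).
Proof.
move=> d0 /map_conjc_real nE /map_conjc_real dE.
exists (map_poly (@complex.Re R) n, map_poly (@complex.Re R) d) => /=.
  by apply: contraNneq d0 => e; rewrite dE e rmorph0.
by rewrite -nE -dE.
Qed.

Lemma positive_real_div n d : d != 0 -> map_poly (@conjc R) n = n ->
  map_poly (@conjc R) d = d -> (forall s, 0 < Re s -> d.[s] != 0) ->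
  positive_real (n%:F / d%:F) <-> forall s, 0 < Re s -> 0 <= Re (n.[s] / d.[s]).
Proof.
move=> d0 nE dE ds; split=> [[_ h] s s0|h].
  by have [_] := h s s0; rewrite rfeval_div // ds.
split; first exact: real_coefs_div.
by move=> s s0; rewrite rfeval_div ?ds //; split; [exact/rfden_root_ndiv/ds|exact: h].
Qed.

(** Both indices of the theorem are instances of this form, since only sizes, coprimality and
    leading coefficients matter. The infimum is finite because domination bounds the ratio below by
    [- K]. *)
Lemma positive_real_threshold n d v :
  map_poly (@conjc R) n = n -> map_poly (@conjc R) d = d ->
  map_poly (@conjc R) v = v ->
  coprimep n d -> (1 < size n)%N -> d != 0 ->
  (size d <= size n)%N -> (size v < size n)%N ->
  (size n = size d -> Re (lead_coef n / lead_coef d) != 0) ->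
  strictly_positive_real (n%:F / d%:F) ->
  let p : ratfun R := v%:F / d%:F in
  let Delta : ratfun R := n%:F / d%:F in
  let admissible : set R :=
    [set r | forall s : R[i], 0 < Re s ->
       0 <= Re (rfeval p s + r%:C * rfeval Delta s)] in
  exists rmin : R,
    [/\ admissible rmin /\ lbound admissible rmin,
        rmin%:E = (- ereal_inf
          [set (Re (rfeval p s) / Re (rfeval Delta s))%:E
             | s in [set s : R[i] | (0 < Re s)%R]])%E
      & forall r : R, positive_real (p + (r%:C)%:P%:F * Delta) <-> rmin <= r].
Proof.
move=> nR dR vR cop sn d0 sdn svn lead0 spr p Delta admissible.
have [e e0 pos] := strictly_positive_real_div cop d0 spr.
have ds s : 0 < Re s -> d.[s] != 0.
  by move=> s0; have [] := pos s (lt_trans _ s0); rewrite ?oppr_lt0.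
have Delta_gt0 s : 0 < Re s -> 0 < Re (n.[s] / d.[s]).
  by move=> s0; apply: (Re_div_gt0 cop sn pos); rewrite (lt_trans _ s0) ?oppr_lt0.
have [K hK] := Re_div_dominated e0 cop sn d0 sdn svn lead0 pos.
pose ratio s := Re (v.[s] / d.[s]) / Re (n.[s] / d.[s]).
pose A := [set ratio s | s in [set s : R[i] | 0 < Re s]].
have A0 : A !=set0 by exists (ratio 1), 1 => //=; exact: ltr01.
have lbA : has_lbound A.
  exists (- K) => _ [s /= s0 <-]; rewrite ler_pdivlMr ?Delta_gt0 //.
  by have := hK s (ltW s0); rewrite mulNr ler_norml => /andP[].
(* The common denominator [d] turns the combination into a single quotient. *)
have admE r : admissible r <->
    forall s, 0 < Re s -> 0 <= Re ((v + r%:C *: n).[s] / d.[s]).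
  have evE s : 0 < Re s -> rfeval p s + r%:C * rfeval Delta s =
      (v + r%:C *: n).[s] / d.[s].
    by move=> /ds dsn; rewrite !rfeval_div // hornerD hornerZ mulrDl mulrA.
  by split=> h s s0; have := h s s0; rewrite evE.
have adm_inf r : admissible r <-> - inf A <= r.
  rewrite admE lerNl; split=> [h|h s s0].
    apply: lb_le_inf => // _ [s /= s0 <-].
    have := h s s0; rewrite hornerD hornerZ mulrDl -mulrA ReD ReMl => h'.
    by rewrite ler_pdivlMr ?Delta_gt0 //; lra.
  have : inf A <= ratio s by apply: ge_inf => //; exists s.
  move=> /(le_trans h); rewrite ler_pdivlMr ?Delta_gt0 // => h'.
  by rewrite hornerD hornerZ mulrDl -mulrA ReD ReMl; lra.
exists (- inf A); split.
- by split; [apply/adm_inf|move=> r /adm_inf].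
- rewrite EFinN -ereal_inf_EFin //; congr (- ereal_inf _)%E.
  rewrite image_comp; apply: eq_imagel => s /= s0.
  by rewrite !rfeval_div ?ds.
move=> r; apply: (iff_trans _ (adm_inf r)); apply: (iff_trans _ (iff_sym (admE r))).
have -> : p + (r%:C)%:P%:F * Delta = (v + r%:C *: n)%:F / d%:F.
  by rewrite -mul_polyC tofracD tofracM mulrDl mulrA.
apply: positive_real_div => //.
by rewrite rmorphD /= vR map_polyZ /= nR oppr0.
Qed.

End RealCoefficients.

(** * Node polynomials and their symmetry under conjugation *)

Section NodePolynomials.
Variables (R : realType) (m : nat) (x : 'I_m -> R[i]).
Implicit Types (a y : 'I_m -> R[i]) (b : R).

Definition node_poly : {poly R[i]} := \prod_(j < m) ('X - (x j)%:P).

(** For distinct nodes, a nonzero multiple of the Lagrange basis polynomial at [x j]. *)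
Definition conode_poly (j : 'I_m) : {poly R[i]} :=
  \prod_(k < m | k != j) ('X - (x k)%:P).

(** Real nodes are fixed and the members of each conjugate pair are swapped. A single [sigma] serves
    all compatible families, so sums and products can be reindexed by it. *)
Lemma conj_closed_involution y : conj_closed_data x y ->
  exists sigma : 'I_m -> 'I_m, forall j,
    [/\ x (sigma j) = conjc (x j), y (sigma j) = conjc (y j) &
        forall c, conj_compatible x c -> c (sigma j) = conjc (c j)].
Proof.
have real_conj (z : R[i]) : Im z = 0 -> z = conjc z.
  by case: z => a b /= ->; rewrite oppr0.
move=> [succ pair real].
suff /boolp.choice[sigma sigmaP] : forall j, exists k, [/\ x k = conjc (x j),
    y k = conjc (y j) & forall c, conj_compatible x c -> c k = conjc (c j)].
  by exists sigma.
move=> j; have [Im0|Imj] := eqVneq (Im (x j)) 0.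
  exists j; split=> [||c [cR _]]; apply: real_conj => //; [exact: real|exact: cR].
have [i [k [Imi kE jE]]] := pair j Imj.
have [k' [k'E xk yk]] := succ i Imi.
have kk : k' = k by apply: val_inj; rewrite /= k'E kE.
move: xk yk; rewrite kk => xk yk.
have [-> {jE}|{}jE] : j = i \/ j = k by [].
  by exists k; split=> // c [_ cC]; exact: cC.
exists i; rewrite jE xk yk !conjcK; split=> // c [_ cC].
by rewrite (cC i k) // conjcK.
Qed.

Lemma size_node_poly : size node_poly = m.+1.
Proof. by rewrite /node_poly -big_enum size_prod_XsubC size_enum_ord. Qed.

Lemma node_poly_monic : node_poly \is monic.
Proof. exact: monic_prod_XsubC. Qed.

Lemma root_node_poly s : root node_poly s -> exists j, s = x j.
Proof.
rewrite /node_poly -(big_map x xpredT (fun z => 'X - z%:P)) root_prod_XsubC.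
by move=> /mapP[j _ ->]; exists j.
Qed.

Lemma size_sum_conode a : (size (\sum_(j < m) a j *: conode_poly j)%R <= m)%N.
Proof.
apply: (big_ind (fun p : {poly R[i]} => size p <= m)%N) => [|p q sp sq|j _].
- by rewrite size_poly0.
- by rewrite (leq_trans (size_polyD _ _)) // geq_max sp.
have := size_node_poly; rewrite /node_poly (bigD1 j) //= -/(conode_poly j).
have c0 : conode_poly j != 0 by rewrite monic_neq0 // monic_prod_XsubC.
rewrite size_mul ?polyXsubC_eq0 // size_XsubC => -[<-].
exact: size_scale_leq.
Qed.

(** At [x j] every term but the [j]-th contains the factor vanishing there. *)
Lemma sum_conode_neq0 a j : injective x -> a j != 0 ->
  (\sum_(i < m) a i *: conode_poly i).[x j] != 0.
Proof.
move=> xinj aj; rewrite horner_sum (bigD1 j) //= big1 ?addr0 => [|i ij].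
  rewrite hornerZ mulf_neq0 // /conode_poly horner_prod.
  by apply/prodf_neq0 => k kj; rewrite hornerXsubC subr_eq0 (inj_eq xinj) eq_sym.
rewrite hornerZ /conode_poly horner_prod (bigD1 j) 1?eq_sym //=.
by rewrite hornerXsubC subrr mul0r mulr0.
Qed.

Section Conjugation.
Variable sigma : 'I_m -> 'I_m.
Hypotheses (sinj : injective sigma) (sigmaE : forall j, x (sigma j) = conjc (x j)).

Lemma conj_node_poly : map_poly (@conjc R) node_poly = node_poly.
Proof.
rewrite /node_poly rmorph_prod /= [RHS](reindex_inj sinj) /=.
by apply: eq_bigr => j _; rewrite map_polyXsubC /= sigmaE.
Qed.

Lemma conj_sum_conode a : (forall j, a (sigma j) = conjc (a j)) ->
  map_poly (@conjc R) (\sum_(j < m) a j *: conode_poly j) =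
  \sum_(j < m) a j *: conode_poly j.
Proof.
move=> aE; rewrite rmorph_sum /= [RHS](reindex_inj sinj) /=.
apply: eq_bigr => j _; rewrite map_polyZ aE /=; congr (_ *: _).
rewrite /conode_poly rmorph_prod /= [RHS](reindex_inj sinj) /=.
apply: eq_big => [k|k _]; first by rewrite (inj_eq sinj).
by rewrite map_polyXsubC /= sigmaE.
Qed.

End Conjugation.
End NodePolynomials.

(* Index k : bool, with k = false for "o" and k = true for "1". *)
Theorem proposition2p13 (R : realType) (m : nat)
  (x y gamma c : 'I_m -> R[i]) (b : R) :
  (0 < m)%N ->
  injective x ->
  (forall j, complex.Re (x j) < 0) ->
  conj_closed_data x y ->
  (forall j, gamma j != 0) -> conj_compatible x gamma ->
  (forall j, c j != 0) -> conj_compatible x c ->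
  b != 0 ->
  let eta : {poly R[i]} := \prod_(j < m) ('X - (x j)%:P) in
  let phi (j : 'I_m) : {poly R[i]} := \prod_(k < m | k != j) ('X - (x k)%:P) in
  let d (k : bool) : {poly R[i]} :=
    if k then b%:C *: eta + \sum_(j < m) c j *: phi j
    else \sum_(j < m) gamma j *: phi j in
  let nu (k : bool) : {poly R[i]} :=
    if k then \sum_(j < m) (y j * c j) *: phi j
    else \sum_(j < m) (y j * gamma j) *: phi j in
  let p (k : bool) : ratfun R := (nu k)%:F / (d k)%:F in
  let Delta (k : bool) : ratfun R := eta%:F / (d k)%:F in
  let f (k : bool) (r : R) : ratfun R := p k + (r%:C)%:P%:F * Delta k in
  strictly_positive_real (Delta false) ->
  strictly_positive_real (Delta true) ->
  forall k : bool,
  let admissible : set R :=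
    [set r | forall s : R[i], 0 < complex.Re s ->
       0 <= complex.Re (rfeval (p k) s + r%:C * rfeval (Delta k) s)] in
  exists rmin : R,
    [/\ admissible rmin /\ lbound admissible rmin,
        rmin%:E = (- ereal_inf
          [set (complex.Re (rfeval (p k) s) / complex.Re (rfeval (Delta k) s))%:E
             | s in [set s : R[i] | (0 < complex.Re s)%R]])%E
      & forall r : R, positive_real (f k r) <-> rmin <= r].
Proof.
move=> m0 xinj xneg closed gamma0 gammaC c0 cC b0 eta phi d nu p Delta f.
have [sigma sigmaP] := conj_closed_involution closed.
have xs j : x (sigma j) = conjc (x j) by have [] := sigmaP j.
have ys j : y (sigma j) = conjc (y j) by have [] := sigmaP j.
have sinj : injective sigma.
  by move=> i j /(congr1 x); rewrite !xs => /(can_inj (@conjcK R))/xinj.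
(* Both denominators have the form [b' * eta + sum]; index o is the case [b' = 0] with
   [a = gamma]. *)
suff main (a : 'I_m -> R[i]) (b' : R) (k : bool) :
    (forall j, a j != 0) -> conj_compatible x a ->
    d k = b'%:C *: eta + \sum_(j < m) a j *: phi j ->
    nu k = \sum_(j < m) (y j * a j) *: phi j ->
    strictly_positive_real (Delta k) ->
    let admissible : set R :=
      [set r | forall s : R[i], 0 < Re s ->
         0 <= Re (rfeval (p k) s + r%:C * rfeval (Delta k) s)] in
    exists rmin : R,
      [/\ admissible rmin /\ lbound admissible rmin,
          rmin%:E = (- ereal_inf
            [set (Re (rfeval (p k) s) / Re (rfeval (Delta k) s))%:E
               | s in [set s : R[i] | (0 < Re s)%R]])%E
        & forall r : R, positive_real (f k r) <-> rmin <= r].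
  move=> spro spr1 [|]; first exact: (main c b).
  by apply: (main gamma 0) => //; rewrite scale0r add0r.
move=> a0 aC dE nuE; rewrite /f /p /Delta.
have as_ j : a (sigma j) = conjc (a j) by have [_ _ h] := sigmaP j; exact: h.
have etaE : map_poly (@conjc R) eta = eta by exact: (conj_node_poly sinj xs).
have seta : size eta = m.+1 by exact: size_node_poly.
have ssum w : (size (\sum_(j < m) w j *: phi j)%R <= m)%N by exact: size_sum_conode.
(* Since [eta] vanishes at the nodes, only the sum contributes; this yields both [d k != 0] and
   coprimality with [eta]. *)
have dx j : (d k).[x j] != 0.
  rewrite dE hornerD hornerZ; have /eqP -> : root eta (x j).
    by rewrite /eta rootE horner_prod (bigD1 j) //= hornerXsubC subrr mul0r.
  by rewrite mulr0 add0r; exact: sum_conode_neq0.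
have ds0 : d k != 0.
  by apply: contraNneq (dx (Ordinal m0)) => ->; rewrite horner0.
apply: positive_real_threshold => //.
- rewrite dE rmorphD /= map_polyZ /= etaE oppr0; congr (_ + _).
  exact: (conj_sum_conode sinj xs as_).
- by rewrite nuE; apply: (conj_sum_conode sinj xs) => j; rewrite ys as_ rmorphM.
- by apply/Pdiv.ClosedField.coprimepP => s /root_node_poly[j ->].
- by rewrite seta.
- rewrite dE (leq_trans (size_polyD _ _)) // geq_max size_scale_leq.
  by rewrite seta (leq_trans (ssum _)).
- by rewrite nuE seta ltnS.
rewrite (monicP (node_poly_monic x)) seta dE => sd.
(* Without the [eta] term the size of [d k] would be at most [m], so equal sizes force [b'] to be
   nonzero; the ratio of leading coefficients is then its inverse. *)
have b'0 : b' != 0.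
  by apply: contraTneq (ssum a) => b'0; rewrite -ltnNge sd b'0 scale0r add0r.
have b'C : b'%:C != 0 :> R[i] by rewrite fmorph_eq0.
rewrite lead_coefDl; last by rewrite size_scale // seta ltnS.
rewrite lead_coefZ (monicP (node_poly_monic x)) mulr1 div1r -fmorphV /=.
by rewrite invr_eq0.
Qed.
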